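(* The function that assigns to a contour in dimension $\ell$ its step function is a bijection between the set of contours in dimension $\ell$ and the set of step functions in dimension $\ell$.
   Context: $[0,\infty)^\ell$ is the poset of $\ell$-tuples of non-negative reals with the coordinatewise order, and $[0,\infty)^\ell_\infty$ is obtained from it by adding an element $\infty$ which is the global maximum. A contour in dimension $\ell$ is a function $\ast\colon[0,\infty)^\ell_\infty\times[0,\infty)\to[0,\infty)^\ell_\infty$ such that: (1) $v\le v\ast t$ for all $v$ and $t$; (2) $v\ast s\le w\ast t$ whenever $v\le w$ and $s\le t$; (3) $(v\ast s)\ast t\le v\ast(s+t)$ for all $v$ and $s,t$; (4) for all $v,w$ in $[0,\infty)^\ell_\infty$, the set $\{t\in[0,\infty)\mid v\ast t\ge w\}$ is either empty or of the form $[a,\infty)$ for some $a\in[0,\infty)$. The step function of a contour $\ast$ is the function $\delta\colon[0,\infty)^\ell_\infty\times[0,\infty)^\ell_\infty\to[0,\infty]$ given by $\delta(v,w):=\inf\{t\in[0,\infty)\mid v\ast t\ge w\}$ (with $\inf\emptyset=\infty$). A step function in dimension $\ell$ is a function $\delta\colon[0,\infty)^\ell_\infty\times[0,\infty)^\ell_\infty\to[0,\infty]$ such that: (1) if $v\le w$, then $\delta(w,v)=0$; (2) if $v\le w$, then $\delta(w,u)\le\delta(v,u)$ for every $u$; (3) $\delta(v,z)\le\delta(v,w)+\delta(w,z)$ for all $v,w,z$; (4) for every $v$ in $[0,\infty)^\ell_\infty$ and $t$ in $[0,\infty)$, the set $\{u\in[0,\infty)^\ell_\infty\mid\delta(v,u)\le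 t\}$ is of the form $\{u\in[0,\infty)^\ell_\infty\mid u\le a\}$ for some $a$ in $[0,\infty)^\ell_\infty$. *)

(* Defs.v *)
From HB Require Import structures.
From mathcomp Require Import all_boot all_order all_algebra.
From mathcomp Require Import interval_inference.
From mathcomp Require Import all_classical all_reals ereal.

Set Implicit Arguments.
Unset Strict Implicit.
Unset Printing Implicit Defensive.

Import Order.TTheory GRing.Theory Num.Theory.

Local Open Scope classical_set_scope.
Local Open Scope ring_scope.

(* [Some x] is the copy of [x : T]; [None] is the adjoined global maximum.
   The alias keeps the order below from becoming an instance on [option]. *)
Definition with_top (T : Type) : Type := option T.

Section WithTop.
Context {d : Order.disp_t} {T : porderType d}.

HB.instance Definition _ := Choice.copy (with_top T) (option T).

Definition with_top_le (x y : with_top T) : bool :=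
  match x, y with
  | _, None => true
  | None, Some _ => false
  | Some a, Some b => (a <= b)%O
  end.

Definition with_top_lt (x y : with_top T) : bool := (y != x) && with_top_le x y.

Fact with_top_le_refl : reflexive with_top_le.
Proof. by case=> //= x. Qed.

Fact with_top_le_anti : antisymmetric with_top_le.
Proof. by case=> [x|] [y|] //= /le_anti ->. Qed.

Fact with_top_le_trans : transitive with_top_le.
Proof. by case=> [y|] [x|] [z|] //=; apply: le_trans. Qed.

HB.instance Definition _ := Order.isPOrder.Build Order.default_display
  (with_top T) (fun _ _ => erefl : with_top_lt _ _ = _)
  with_top_le_refl with_top_le_anti with_top_le_trans.

Fact with_top_lex1 (x : with_top T) : (x <= (None : with_top T))%O.
Proof. by case: x. Qed.

HB.instance Definition _ :=
  Order.hasTop.Build Order.default_display (with_top T) with_top_lex1.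

End WithTop.

(* [l.-tupleprod] (rather than [l.-tuple]) carries the coordinatewise order. *)
Definition nnvec_top (R : realType) (l : nat) : Type :=
  with_top (l.-tupleprod {nonneg R}).

HB.instance Definition _ (R : realType) (l : nat) :=
  Order.TPOrder.copy (nnvec_top R l) (with_top (l.-tupleprod {nonneg R})).

Record is_contour (R : realType) (l : nat)
    (c : nnvec_top R l -> {nonneg R} -> nnvec_top R l) : Prop := IsContour {
  contour_ge : forall (v : nnvec_top R l) (t : {nonneg R}), (v <= c v t)%O ;
  contour_mono : forall (v w : nnvec_top R l) (s t : {nonneg R}),
    (v <= w)%O -> s <= t -> (c v s <= c w t)%O ;
  contour_add : forall (v : nnvec_top R l) (s t : {nonneg R}),
    (c (c v s) t <= c v (s%:num + t%:num)%:nng)%O ;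
  contour_closed : forall v w : nnvec_top R l,
    [set t | (w <= c v t)%O] = set0 \/
    exists a : {nonneg R}, [set t | (w <= c v t)%O] = [set` `[a, +oo[] }.

Definition step_of_contour (R : realType) (l : nat)
    (c : nnvec_top R l -> {nonneg R} -> nnvec_top R l)
    (v w : nnvec_top R l) : \bar R :=
  ereal_inf [set (t%:num)%:E | t in [set t : {nonneg R} | (w <= c v t)%O]].

(* [step_ge0] encodes the codomain [0, +oo]. *)
Record is_step_function (R : realType) (l : nat)
    (delta : nnvec_top R l -> nnvec_top R l -> \bar R) : Prop :=
    IsStepFunction {
  step_ge0 : forall v w : nnvec_top R l, (0 <= delta v w)%E ;
  step_eq0 : forall v w : nnvec_top R l, (v <= w)%O -> delta w v = 0%E ;
  step_mono : forall v w u : nnvec_top R l,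
    (v <= w)%O -> (delta w u <= delta v u)%E ;
  step_triangle : forall v w z : nnvec_top R l,
    (delta v z <= delta v w + delta w z)%E ;
  step_principal : forall (v : nnvec_top R l) (t : {nonneg R}),
    exists a : nnvec_top R l,
      [set u | (delta v u <= (t%:num)%:E)%E] = [set u | (u <= a)%O] }.

Definition contours (R : realType) (l : nat) :
    set (nnvec_top R l -> {nonneg R} -> nnvec_top R l) :=
  [set c | is_contour c].

Definition step_functions (R : realType) (l : nat) :
    set (nnvec_top R l -> nnvec_top R l -> \bar R) :=
  [set delta | is_step_function delta].

(* Main.v *)
(** The step function determines the contour through the adjunction
    [delta v w <= t <-> w <= v * t], which holds because the set of times
    [t] with [w <= v * t] is closed; every axiom on one side translates through
    it into an axiom on the other, and conversely [v * t] is recovered as the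
    greatest [w] with [delta v w <= t]. *)
Require Import Defs.
From mathcomp Require Import all_boot all_order all_algebra.
From mathcomp Require Import interval_inference.
From mathcomp Require Import all_classical all_reals ereal.

Set Implicit Arguments.
Unset Strict Implicit.
Unset Printing Implicit Defensive.

Import Order.TTheory GRing.Theory Num.Theory.

Local Open Scope classical_set_scope.
Local Open Scope ring_scope.

Section ContourStep.
Variables (R : realType) (l : nat).
Implicit Types (v w u : nnvec_top R l) (t : {nonneg R}).
Implicit Types (c : nnvec_top R l -> {nonneg R} -> nnvec_top R l).
Implicit Types (delta : nnvec_top R l -> nnvec_top R l -> \bar R).

(** The adjunction speaks of finite times only. This split turns a value of a step function into
    such a time or isolates the case [+oo]. *)
Lemma fin_or_pinfty_of_ge0 (x : \bar R) :
  (0 <= x)%E -> x = +oo%E \/ exists t, x = (t%:num)%:E.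
Proof.
case: x => [r|_|//]; last by left.
by rewrite lee_fin => r0; right; exists (NngNum r0).
Qed.

Lemma step_of_contour_ge0 c v w : (0 <= step_of_contour c v w)%E.
Proof. by apply: le_ereal_inf_tmp => _ [t _ <-]; rewrite lee_fin. Qed.

(** From right to left, [t] is one of the times whose infimum is taken. From left to right, a finite
    bound excludes the empty set, and closedness then makes the infimum a minimum [a], with every
    later time also qualifying. *)
Lemma step_of_contour_leP c v w t :
  is_contour c -> (step_of_contour c v w <= (t%:num)%:E)%E <-> (w <= c v t)%O.
Proof.
move=> cc; split=> [dt|wt]; last by apply: ereal_inf_lbound; exists t.
have [E0|[a Ea]] := contour_closed cc v w.
  by move: dt; rewrite /step_of_contour E0 image_set0 ereal_inf0 leye_eq.
suff a_le_t : a <= t.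
  by have : [set` `[a, +oo[] t; [rewrite /= in_itv /= a_le_t|rewrite -Ea].
rewrite -num_le -lee_fin; apply: le_trans dt.
apply: le_ereal_inf_tmp => _ [s + <-]; rewrite Ea /= in_itv /= andbT.
by rewrite lee_fin num_le.
Qed.

Lemma step_of_contourP c : is_contour c -> is_step_function (step_of_contour c).
Proof.
move=> cc; split.
- exact: step_of_contour_ge0.
- move=> v w vw; apply/le_anti; rewrite step_of_contour_ge0 andbT.
  apply/(step_of_contour_leP _ _ (0%:nng : {nonneg R}) cc).
  exact: le_trans vw (contour_ge cc _ _).
- move=> v w u vw.
  have [->|[t dt]] := fin_or_pinfty_of_ge0 (step_of_contour_ge0 c v u).
    exact: leey.
  rewrite dt; apply/(step_of_contour_leP _ _ _ cc).
  apply: (@le_trans _ _ (c v t)); last exact: (contour_mono cc).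
  by apply/(step_of_contour_leP _ _ _ cc); rewrite dt.
- move=> v w z.
  have [->|[s ds]] := fin_or_pinfty_of_ge0 (step_of_contour_ge0 c v w).
    by rewrite addye ?leey // gt_eqF // (lt_le_trans _ (step_of_contour_ge0 _ _ _)).
  have [->|[t dt]] := fin_or_pinfty_of_ge0 (step_of_contour_ge0 c w z).
    by rewrite addey ?leey // ds.
  (* For finite values the chain is [z <= c w t <= c (c v s) t <= c v (s + t)]. *)
  rewrite ds dt -EFinD.
  apply/(step_of_contour_leP _ _ (s%:num + t%:num)%:nng cc).
  apply: le_trans (contour_add cc v s t).
  apply: (@le_trans _ _ (c w t)).
    by apply/(step_of_contour_leP _ _ _ cc); rewrite dt.
  apply: (contour_mono cc) => //.
  by apply/(step_of_contour_leP _ _ _ cc); rewrite ds.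
- move=> v t; exists (c v t); apply/seteqP; split=> u /=;
  by move/(step_of_contour_leP _ _ _ cc).
Qed.

(** Evaluating the common step function at [v] and [c v t] gives at most [t], by reflexivity; the
    adjunction for [c'] then yields [c v t <= c' v t], and symmetrically. *)
Lemma step_of_contour_inj c c' : is_contour c -> is_contour c' ->
  step_of_contour c = step_of_contour c' -> c = c'.
Proof.
move=> cc cc' cE; apply/funext => v; apply/funext => t.
apply/le_anti/andP; split.
- by apply/(step_of_contour_leP _ _ _ cc'); rewrite -cE; apply/step_of_contour_leP.
- by apply/(step_of_contour_leP _ _ _ cc); rewrite cE; apply/step_of_contour_leP.
Qed.

Section Adjunction.
Variables (delta : nnvec_top R l -> nnvec_top R l -> \bar R)
          (c : nnvec_top R l -> {nonneg R} -> nnvec_top R l).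
Hypothesis (step_delta : is_step_function delta).
Hypothesis (adj : forall v w t, (delta v w <= (t%:num)%:E)%E <-> (w <= c v t)%O).

Lemma contour_of_adjunction : is_contour c.
Proof.
split.
- by move=> v t; apply/adj; rewrite (step_eq0 step_delta) // lee_fin.
- move=> v w s t vw st; apply/adj.
  apply: le_trans (step_mono step_delta _ vw) _.
  apply: (@le_trans _ _ (s%:num)%:E); first exact/adj.
  by rewrite lee_fin num_le.
- move=> v s t; apply/adj.
  (* With [c v s] as intermediate point, the two summands are at most [s] and [t], by the adjunction
     at reflexive inequalities. *)
  apply: le_trans (step_triangle step_delta _ (c v s) _) _.
  by rewrite /= EFinD leeD //; apply/adj.
- move=> v w.
  (* The times in question are those above [delta v w]: none if it is [+oo], otherwise a closed ray
     starting at it. *)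
  have [dE|[a dE]] := fin_or_pinfty_of_ge0 (step_ge0 step_delta v w).
    by left; apply/seteqP; split=> // t /= /adj; rewrite dE leye_eq.
  right; exists a; apply/seteqP; split=> t /=; rewrite in_itv /= andbT.
    by move/adj; rewrite dE lee_fin num_le.
  by move=> a_le_t; apply/adj; rewrite dE lee_fin num_le.
Qed.

Lemma step_of_contour_of_adjunction : step_of_contour c = delta.
Proof.
apply/funext => v; apply/funext => w; apply/le_anti/andP; split.
- have [->|[t dE]] := fin_or_pinfty_of_ge0 (step_ge0 step_delta v w).
    exact: leey.
  (* A finite [delta v w] is itself a qualifying time. *)
  by rewrite dE; apply: ereal_inf_lbound; exists t => //=; apply/adj; rewrite dE.
- by apply: le_ereal_inf_tmp => _ [t /= wt <-]; apply/adj.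
Qed.

End Adjunction.

(** A principal down-set has a unique generator, so choice merely collects these generators into a
    function of [v] and [t]. *)
Lemma step_function_adjunction delta : is_step_function delta ->
  exists c, forall v w t, (delta v w <= (t%:num)%:E)%E <-> (w <= c v t)%O.
Proof.
move=> sd.
have [f fP] := choice (fun vt => step_principal sd vt.1 vt.2).
exists (fun v t => f (v, t)) => v w t.
by have /seteqP[/(_ w) ? /(_ w) ?] := fP (v, t).
Qed.

End ContourStep.

Theorem proposition6p6 (R : realType) (l : nat) :
  set_bij (@contours R l) (@step_functions R l) (@step_of_contour R l).
Proof.
split.
- by move=> c; exact: step_of_contourP.
- by move=> c c' /set_mem cc /set_mem cc'; exact: step_of_contour_inj.
- move=> delta sd; have [c adj] := step_function_adjunction sd.
  exists c; first exact: contour_of_adjunction sd adj.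
  exact: step_of_contour_of_adjunction sd adj.
Qed.
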